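(* Let $H$ be a non-empty subset of a path-connected topological group $G$. Then $\operatorname{TC}(G,H)=\operatorname{cat}(G)$.
   Context: For a continuous map (fibration) $f:E\to B$, the Schwarz genus $\operatorname{genus}(f)$ is the smallest $k$ such that $B$ has an open cover $U_1,\dots,U_k$ for which each $U_i$ admits a continuous section $s_i:U_i\to E$ of $f$. For a space $X$ and $Y\subseteq X$, let $P_{X\times Y}$ be the space of continuous paths $\gamma:[0,1]\to X$ with $\gamma(1)\in Y$, and let $\pi:P_{X\times Y}\to X\times Y$, $\pi(\gamma)=(\gamma(0),\gamma(1))$. The relative topological complexity of the pair is $\operatorname{TC}(X,Y)=\operatorname{genus}(\pi)$ (unreduced convention). For a pointed space $(X,x_0)$, let $P_0X$ be the space of paths $\sigma$ in $X$ with $\sigma(1)=x_0$ and $p_0:P_0X\to X\times\{x_0\}$, $p_0(\sigma)=(\sigma(0),x_0)$. The Lusternik-Schnirelmann category is $\operatorname{cat}(X)=\operatorname{genus}(p_0)$; for path-connected $X$ it does not depend on $x_0$. *)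

(* Defs.v *)
From HB Require Import structures.
From mathcomp Require Import all_boot all_order all_algebra.
From mathcomp Require Import all_classical all_reals all_analysis homotopy.

Set Implicit Arguments.
Unset Strict Implicit.
Unset Printing Implicit Defensive.

Import Order.TTheory GRing.Theory Num.Theory.
Import numFieldNormedType.Exports.
Local Open Scope classical_set_scope.
Local Open Scope ring_scope.

HB.structure Definition PreTopologicalGroup := {G of Topological G & Group G}.

(* No separation axiom is required. *)
HB.mixin Record PreTopologicalGroup_isTopologicalGroup G
    & PreTopologicalGroup G := {
  mulg_continuous : continuous (fun x : G * G => (x.1 * x.2)%g) ;
  invg_continuous : continuous (fun x : G => (x^-1)%g)
}.

#[short(type="topologicalGroupType")]
HB.structure Definition TopologicalGroup :=
  {G of PreTopologicalGroup G & PreTopologicalGroup_isTopologicalGroup G}.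

Definition unit_interval (R : realType) : Type := set_type `[0 : R, 1].

HB.instance Definition _ (R : realType) :=
  Topological.copy (unit_interval R) (set_type `[0 : R, 1]).

Section unit_interval_endpoints.
Context (R : realType).

Local Lemma unit_interval0 : (0 : R) \in `[0 : R, 1]%classic.
Proof. by rewrite inE /= in_itv /= lexx ler01. Qed.

Local Lemma unit_interval1 : (1 : R) \in `[0 : R, 1]%classic.
Proof. by rewrite inE /= in_itv /= lexx ler01. Qed.

Let zero_unit : unit_interval R := exist _ 0 unit_interval0.
Let one_unit : unit_interval R := exist _ 1 unit_interval1.

Local Lemma zero_one_unit : zero_unit != one_unit.
Proof. by apply/eqP => /(congr1 val) /= /eqP; rewrite eq_sym oner_eq0. Qed.

HB.instance Definition _ :=
  @isBiPointed.Build (unit_interval R) zero_unit one_unit zero_one_unit.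

End unit_interval_endpoints.

Definition path_connected (R : realType) (X : topologicalType) : Prop :=
  forall x y : X, inhabited {path unit_interval R from x to y}.

Section genus.
Context {E B : topologicalType} (f : continuousType E B).

Definition has_sectional_cover (k : nat) : Prop :=
  exists U : 'I_k -> set B,
    [/\ forall i, open (U i),
        \bigcup_i U i = [set: B] &
        forall i, exists s : U i -> E,
          continuous s /\ forall b : U i, f (s b) = \val b].

(* [None] is the value infinity: no finite cover with sections exists. *)
Definition genus : option nat :=
  if pselect (exists k, `[< has_sectional_cover k >]) is left h
  then Some (ex_minn h) else None.

End genus.

Lemma eval_compact_open_continuous (T U : topologicalType) (t : T) :
  continuous (fun g : {compact-open, T -> U} => g t).
Proof.
apply/continuousP => O oO.
rewrite [X in open X](_ : _ =
    [set g : {compact-open, T -> U} | g @` [set t] `<=` O]).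
  exact: compact_open_open (@compact_set1 _ t) oO.
by apply/seteqP; split => g /=; rewrite image_set1 sub1set inE.
Qed.

Section path_spaces.
Context (R : realType) {X : topologicalType}.
Local Notation I := (unit_interval R).

(* As sets of functions coerced to types, the path spaces below carry the
   subspace topology inherited from the compact-open topology. *)
Definition path_space (Y : set X) : set {compact-open, I -> X} :=
  [set g | continuous (g : I -> X) /\ Y (g one)].

Lemma path_space_one (Y : set X) (g : path_space Y) :
  (\val g : I -> X) one \in Y.
Proof. by have [_] := set_valP g; rewrite inE. Qed.

Definition path_ends (Y : set X) (g : path_space Y) : X * Y :=
  ((\val g : I -> X) zero, exist _ ((\val g : I -> X) one) (path_space_one g)).

Lemma path_ends_continuous (Y : set X) : continuous (@path_ends Y).
Proof.
have ev t : continuous (fun g : path_space Y => (\val g : I -> X) t).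
  move=> g; apply: (@continuous_comp _ {compact-open, I -> X} _
    set_val (fun h : {compact-open, I -> X} => h t)).
    exact: initial_continuous.
  exact: eval_compact_open_continuous.
move=> g.
have start_g : (path_ends h).1 @[h --> g] --> (path_ends g).1 by exact: ev.
have end_g : (path_ends h).2 @[h --> g] --> (path_ends g).2.
  apply: (continuous_comp_initial (w := set_val : Y -> X)
    (f := fun h : path_space Y => (path_ends h).2)).
  exact: (ev one).
by have := cvg_pair start_g end_g; apply; exact: nbhs_filter.
Qed.

HB.instance Definition _ (Y : set X) :=
  @isContinuous.Build _ _ (@path_ends Y) (@path_ends_continuous Y).

Definition TC (Y : set X) : option nat := genus (@path_ends Y).

Definition based_path_space (x0 : X) : set {compact-open, I -> X} :=
  [set g | continuous (g : I -> X) /\ g one = x0].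

Definition based_path_start (x0 : X) (g : based_path_space x0) : X * [set x0] :=
  ((\val g : I -> X) zero, exist _ x0 (mem_set (erefl x0))).

Lemma based_path_start_continuous (x0 : X) : continuous (@based_path_start x0).
Proof.
move=> g.
have start_g :
    (based_path_start h).1 @[h --> g] --> (based_path_start g).1.
  apply: (@continuous_comp _ {compact-open, I -> X} _
    set_val (fun h : {compact-open, I -> X} => h zero)).
    exact: initial_continuous.
  exact: eval_compact_open_continuous.
have end_g : (based_path_start h).2 @[h --> g] --> (based_path_start g).2.
  by have := cvg_cst (based_path_start g).2; apply; exact: nbhs_filter.
by have := cvg_pair start_g end_g; apply; exact: nbhs_filter.
Qed.

HB.instance Definition _ (x0 : X) :=
  @isContinuous.Build _ _ (@based_path_start x0)
    (@based_path_start_continuous x0).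

Definition LScat (x0 : X) : option nat := genus (@based_path_start x0).

End path_spaces.

(* Main.v *)
Require Import Defs.
From mathcomp Require Import all_boot all_order all_algebra.
From mathcomp Require Import all_classical all_reals all_analysis.

(** In a group, a path [g] can be translated so that it ends at a prescribed
    point [y]: take [t |-> g t * (g 1)^-1 * y].  Given non-empty subsets [Y],
    [Y'] of [G] and a point [y0] of [Y], the map
      [(x, y) |-> (x * y^-1 * y0, y0)]
    sends [G * Y'] to [G * Y], and a path joining the two components of the
    image of [(x, y)] becomes, once translated to end at [y], a path from [x]
    to [y].  Open sets and local sections of the endpoint fibration over
    [G * Y] therefore pull back to [G * Y'], so that relative topological
    complexity takes the same value on all non-empty subsets of [G]
    ([TC_nonempty_eq]).  Applied to [H] and the singleton
    [{x0}], this is the claim, because the relative complexity of [{x0}] is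
    the category of [G] based at [x0] ([LScat_TC_set1]).

    Continuity of the translation in the compact-open topology follows from the
    exponential law: the interval is compact and regular, hence evaluation of
    paths is jointly continuous ([path_eval_continuous]), and a map into a
    space of paths is continuous as soon as the associated map of two variables
    is ([continuous_into_paths]). *)

Set Implicit Arguments.
Unset Strict Implicit.
Unset Printing Implicit Defensive.

Import Order.TTheory GRing.Theory Num.Theory.
Import numFieldNormedType.Exports.
Local Open Scope classical_set_scope.

(** * Globally continuous maps *)

Lemma continuousT_comp (T U V : topologicalType) (f : T -> U) (g : U -> V) :
  continuous f -> continuous g -> continuous (fun t => g (f t)).
Proof. by move=> cf cg t; exact: (continuous_comp (cf t) (cg (f t))). Qed.

Lemma continuousT_pair (T U V : topologicalType) (f : T -> U) (g : T -> V) :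
  continuous f -> continuous g -> continuous (fun t => (f t, g t)).
Proof.
by move=> cf cg t; apply: (cvg_pair (cf t) (cg t)); exact: nbhs_filter.
Qed.

Lemma continuousT_fst (T U : topologicalType) :
  continuous (fun z : T * U => z.1).
Proof. by move=> z; exact: cvg_fst. Qed.

Lemma continuousT_snd (T U : topologicalType) :
  continuous (fun z : T * U => z.2).
Proof. by move=> z; exact: cvg_snd. Qed.

(** * Comparison of sectional covers *)

(** The total spaces need not be related by a bundle map over [phi]: [Psi] may
    use the target point, and it is required to lie over that point only where
    a section of [f] composed with [phi] provides its first argument. *)
Lemma has_sectional_cover_pullback (E B E' B' : topologicalType)
    (f : continuousType E B) (f' : continuousType E' B')
    (phi : B' -> B) (Psi : E * B' -> E') (k : nat) :
  continuous phi -> continuous Psi ->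
  (forall e b, f e = phi b -> f' (Psi (e, b)) = b) ->
  has_sectional_cover f k -> has_sectional_cover f' k.
Proof.
move=> cphi cPsi fPsi [U [oU cU sU]].
exists (fun i => phi @^-1` U i); split.
- by move=> i; apply: open_comp => // b _; exact: cphi.
- apply/seteqP; split => // b _.
  have : (\bigcup_i U i) (phi b) by rewrite cU.
  by case=> i _ Ui; exists i.
- move=> i; have [s [cs fs]] := sU i.
  have phiU (b : phi @^-1` U i) : phi (\val b) \in U i.
    by rewrite inE; exact: (set_valP b).
  pose r (b : phi @^-1` U i) : U i := exist _ (phi (\val b)) (phiU b).
  have cval : continuous (set_val : phi @^-1` U i -> B').
    exact: initial_continuous.
  have cr : continuous r.
    apply: (continuous_comp_initial (w := set_val : U i -> B)).
    exact: continuousT_comp cval cphi.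
  exists (fun b => Psi (s (r b), \val b)); split.
    apply: (continuousT_comp _ cPsi).
    by apply: continuousT_pair; [exact: continuousT_comp cr cs | exact: cval].
  by move=> b; apply: fPsi; rewrite fs.
Qed.

Lemma genus_eq (E B E' B' : topologicalType)
    (f : continuousType E B) (f' : continuousType E' B') :
  (forall k, has_sectional_cover f k <-> has_sectional_cover f' k) ->
  genus f = genus f'.
Proof.
move=> ff'; have eqff' : has_sectional_cover f = has_sectional_cover f'.
  by apply/funext => k; apply/propext.
by rewrite /genus eqff'.
Qed.

(** * The exponential law for paths *)

Section path_evaluation.
Context (R : realType).
Local Notation I := (unit_interval R).

(** The subtype carries the initial topology, so compactness is transferred
    from the segment of the line along the retraction that clamps [t] to
    [[0, 1]]. *)
Lemma unit_interval_compact : compact [set: I].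
Proof.
have clamp_in (t : R) : Num.max 0%R (Num.min 1%R t) \in `[0%R : R, 1%R]%classic.
  by rewrite inE /= in_itv /= le_max lexx /= ge_max ler01 ge_min lexx.
pose clamp (t : R) : I := exist _ (Num.max 0%R (Num.min 1%R t)) (clamp_in t).
have cclamp : continuous clamp.
  apply: (continuous_comp_initial
    (w := set_val : `[0%R : R, 1%R]%classic -> R)) => t.
  apply: (@continuous_max R R (fun _ => 0%R) (fun t => Num.min 1%R t) t).
    exact: cst_continuous.
  apply: (@continuous_min R R (fun _ => 1%R) id t); last exact: cvg_id.
  exact: cst_continuous.
have <- : clamp @` `[0%R, 1%R]%classic = [set: I].
  apply/seteqP; split => // x _; exists (\val x); first exact: (set_valP x).
  apply: val_inj => /=.
  have := set_valP x; rewrite /= in_itv /= => /andP[x0 x1].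
  by rewrite (min_idPr x1) (max_idPr x0).
apply: continuous_compact; last exact: segment_compact.
exact: continuous_subspaceT.
Qed.

Lemma unit_interval_locally_compact : locally_compact [set: I].
Proof.
move=> x _; exists [set: I]; first exact: filterT.
by split; [exact: unit_interval_compact | exact: closedT].
Qed.

Lemma unit_interval_regular : regular_space I.
Proof. exact: (@uniform_regular (set_type `[0%R : R, 1%R]%classic)). Qed.

Context (X : topologicalType) (P : set {compact-open, I -> X}).

(** Members of a compact-open function space may be discontinuous, and
    evaluation is jointly continuous only along the continuous ones. *)
Lemma path_eval_continuous :
  P `<=` [set g | continuous (g : I -> X)] ->
  continuous (fun z : P * I => (\val z.1 : I -> X) z.2).
Proof.
move=> cP.
rewrite (_ : (fun z => _) =
    uncurry (fun g : P => (\val g : I -> X))); last first.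
  by apply/funext => -[].
apply: (@continuous_uncurry_regular P I X (fun g => (\val g : I -> X))).
- exact: unit_interval_locally_compact.
- exact: unit_interval_regular.
- exact: initial_continuous.
- by move=> g; exact: (cP _ (set_valP g)).
Qed.

Lemma continuous_into_paths (T : topologicalType) (F : T -> P) :
  continuous (fun z : T * I => (\val (F z.1) : I -> X) z.2) -> continuous F.
Proof.
move=> cF.
apply: (continuous_comp_initial (w := set_val : P -> {compact-open, I -> X})).
exact: (continuous_curry_fun cF).
Qed.

End path_evaluation.

(** * Translation of paths in a topological group *)

Section translation.
Context (R : realType) (G : topologicalGroupType).
Local Notation I := (unit_interval R).
Local Open Scope group_scope.

Lemma continuousM (T : topologicalType) (u v : T -> G) :
  continuous u -> continuous v -> continuous (fun t => u t * v t).
Proof.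
move=> cu cv.
exact: (continuousT_comp (continuousT_pair cu cv) mulg_continuous).
Qed.

Lemma continuousV (T : topologicalType) (u : T -> G) :
  continuous u -> continuous (fun t => (u t)^-1).
Proof. by move=> cu; exact: (continuousT_comp cu invg_continuous). Qed.

Definition translate_end (g : I -> G) (y : G) : I -> G :=
  fun t => g t * (g one)^-1 * y.

Lemma translate_end_path_space (Y : set G) (g : I -> G) (y : Y) :
  continuous g -> translate_end g (\val y) \in path_space Y.
Proof.
move=> cg; rewrite inE; split; last first.
  by rewrite /translate_end mulgV mul1g; exact: (set_valP y).
apply: continuousM; last exact: cst_continuous.
by apply: continuousM => //; exact: cst_continuous.
Qed.

Lemma has_sectional_cover_path_ends (Y Y' : set G) (k : nat) : Y !=set0 ->
  has_sectional_cover (@path_ends R G Y) k ->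
  has_sectional_cover (@path_ends R G Y') k.
Proof.
move=> [y0 Yy0].
pose y0' : Y := exist _ y0 (mem_set Yy0).
have cpath (Z : set G) :
    @path_space R G Z `<=` [set g | continuous (g : I -> G)] by move=> g [].
pose phi (b : G * Y') : G * Y := (b.1 * (\val b.2)^-1 * y0, y0').
pose Psi (z : @path_space R G Y * (G * Y')) : @path_space R G Y' :=
  exist _ (translate_end (\val z.1) (\val z.2.2))
    (translate_end_path_space z.2.2 (cpath _ _ (set_valP z.1))).
have cval : continuous (set_val : Y' -> G) by exact: initial_continuous.
apply: (@has_sectional_cover_pullback _ _ _ _ _ _ phi Psi).
- apply: continuousT_pair; last exact: cst_continuous.
  apply: continuousM; last exact: cst_continuous.
  apply: continuousM; first exact: continuousT_fst.
  apply: continuousV.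
  exact: continuousT_comp (@continuousT_snd _ _) cval.
- apply: continuous_into_paths.
  pose T := ((@path_space R G Y * (G * Y')) * I)%type.
  have ceval (p : T -> I) : continuous p ->
      continuous (fun z : T => (\val z.1.1 : I -> G) (p z)).
    move=> cp.
    apply: (continuousT_comp (f := fun z : T => (z.1.1, p z)) _
      (path_eval_continuous (cpath Y))).
    apply: continuousT_pair => //.
    exact: continuousT_comp (@continuousT_fst _ _) (@continuousT_fst _ _).
  apply: (@continuousM T
    (fun z => (\val z.1.1 : I -> G) z.2 * ((\val z.1.1 : I -> G) one)^-1)
    (fun z => \val z.1.2.2)).
    apply: continuousM; first by apply: ceval; exact: continuousT_snd.
    by apply/continuousV/(ceval (fun=> one)); exact: cst_continuous.
  apply: continuousT_comp cval.
  apply: continuousT_comp (@continuousT_snd _ _).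
  exact: continuousT_comp (@continuousT_fst _ _) (@continuousT_snd _ _).
- move=> g [x y] [g0 g1]; congr pair.
    by rewrite /= /translate_end g0 g1 mulgK mulgVK.
  by apply: val_inj; rewrite /= /translate_end mulgV mul1g.
Qed.

Lemma TC_nonempty_eq (Y Y' : set G) :
  Y !=set0 -> Y' !=set0 -> TC R Y = TC R Y'.
Proof.
by move=> Y0 Y'0; apply: genus_eq => k; split;
  exact: has_sectional_cover_path_ends.
Qed.

End translation.

(** The paths ending at [x0] are, by computation, the paths ending in the
    singleton of [x0]; only the proofs carried by the second endpoint of the
    two fibrations differ. *)
Lemma LScat_TC_set1 (R : realType) (X : topologicalType) (x0 : X) :
  LScat R x0 = TC R [set x0].
Proof.
have ends (g : based_path_space x0) :
    based_path_start g = @path_ends R X [set x0] g.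
  congr pair; apply: val_inj => /=.
  by have [_] := set_valP g.
apply: genus_eq => k; split;
  apply: (@has_sectional_cover_pullback _ _ _ _ _ _ id fst).
- by move=> b; exact: cvg_id.
- exact: continuousT_fst.
- by move=> g b <-; rewrite /= ends.
- by move=> b; exact: cvg_id.
- exact: continuousT_fst.
- by move=> g b <-; rewrite /= ends.
Qed.

Theorem corollary3p6 (R : realType) (G : topologicalGroupType) (H : set G)
    (x0 : G) :
  path_connected R G -> H !=set0 -> TC R H = LScat R x0.
Proof.
move=> _ H0; rewrite LScat_TC_set1.
by apply: TC_nonempty_eq => //; exists x0.
Qed.
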